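(* Consider the co-design problem of minimizing, over joint policies $\mu=(\mu^m,\mu^p)$, the average cost $$J(s_0,\mu^m,\mu^p)=\lim_{T\to\infty}\frac1T\,\mathbb E_{s_0}^{\mu^m,\mu^p}\Big\{\sum_{k=0}^{T}c_M(s_k,a_k)+\lambda c_p(p_k)\Big\}$$ subject to the safety constraint $$\theta^T\overline\pi<\frac{1-\lambda_1\varrho}{\varrho(\lambda_0-\lambda_1)},$$ where $\theta=[\theta(s,p)]_{(s,p)\in S\times\Omega_p}$ and $\overline\pi$ is the stationary distribution of the joint state $(s_k,p_k)$ under $\mu$. Suppose the unichain assumption holds. Let $\{X_1^*(s,a)\}$, $\{X_2^*(s,p)\}$ be optimal solutions of the linear program $$\min_{\{X_1(s,a)\}\ge0,\ \{X_2(s,p)\}\ge0}\ \sum_{s\in S,\,a\in A(s)}X_1(s,a)c_M(s,a)+\lambda\sum_{s\in S,\,p\in\Omega_p}X_2(s,p)c_p(p)$$ subject to $$\sum_{a\in A(s')}X_1(s',a)-\sum_{s\in S,\,a\in A(s)}p(s'|s,a)X_1(s,a)=0\quad\forall s'\in S,$$ $$\sum_{s\in S,\,a\in A(s)}X_1(s,a)=1,\qquad\sum_{s\in S,\,p\in\Omega_p}X_2(s,p)=1,$$ $$\sum_{s\in S,\,p\in\Omega_p}\theta(s,p)X_2(s,p)<\frac{1-\lambda_1\varrho}{\varrho(\lambda_0-\lambda_1)}.$$ Then the optimal control and communication policies of the co-design problem are the stationary policies given, at state $s\in S$, by $$\mu_\infty^m(a)=\frac{X_1^*(s,a)}{\sum_{a\in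 A(s)}X_1^*(s,a)},\qquad\mu_\infty^p(p')=\frac{X_2^*(s,p')}{\sum_{p'\in\Omega_p}X_2^*(s,p')}.$$
   Context: MDP. A Markov decision process has finite state set $S=\{1,\dots,N\}$, finite action set $A$ (with $A(s)$ the actions available at $s$), transition probabilities $p(s'|s,a)$ from $s$ to $s'$ under action $a$, and costs $c_M(s,a)\in\mathbb R_+$. $\Omega_p=\{p_1,\dots,p_M\}$ is a finite set of transmission power levels, with costs $c_p(p)$, $p\in\Omega_p$. $\lambda>0$ is a constant. Dropout probabilities. $\theta(s,p)\in[0,1)$, $(s,p)\in S\times\Omega_p$, is the probability that a packet is dropped when the MDP state is $s$ and the power is $p$; it is monotonically decreasing in $p$. The constants $\varrho,\lambda_0,\lambda_1>0$ (growth constants of a family of Lyapunov functions for the controlled plant, with index 0 for packet dropped and 1 for packet received) satisfy $\lambda_0>\lambda_1$ and $\varrho\lambda_1<1$. Policies. $\mu^m=\{\mu_k^m\}$ and $\mu^p=\{\mu_k^p\}$ are sequences of conditional distributions, given the history of states, actions and powers up to time $k$, over actions in $A$ and powers in $\Omega_p$ respectively: $\mu_k^m(a)=\Pr\{a\mid h_k\}$, $\mu_k^p(p')=\Pr\{p'\mid h_k\}$, with $h_k=(s_1,a_1,p_1,\dots,s_{k-1},a_{k-1},p_{k-1},s_k)$. A policy is stationary if it is time homogeneous and depends only on the current state: $\mu_\infty^m=\Pr\{a\mid s\}$, $\mu_\infty^p=\Pr\{p\mid s\}$. $\mathbb E_{s_0}^{\mu^m,\mu^p}$ is expectation under these policies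 with initial state $s_0$. Under a stationary policy, $\overline\pi(s,p)=\mathbb P\{p\mid s\}\pi(s)$ with $\pi$ the stationary distribution of the MDP state. Unichain assumption. Let $P_k=P(\mu_k^m)$ be the transition matrix of the MDP under $\mu_k^m$. For any given $n>0$ and all $1\le k\le n$, the product $\prod_{i=1}^kP_i$ of the stochastic matrices induced by any selected control policy $(\mu_1^m,\dots,\mu_k^m)$ is aperiodic and has a single ergodic class. The decision variables $\{X_1(s,a)\}$ and $\{X_2(s,p)\}$ represent probability distributions over state-action pairs and state-power pairs.
   Formalization: The linear program is given the additional constraint that X_1 and X_2 have the same state marginal, sum_a X_1(s,a) = sum_p X_2(s,p) for every s; without it X_2 is unrelated to the transition probabilities and the claim fails. *)

(* Defs.v *)
From HB Require Import structures.
From mathcomp Require Import all_boot all_order all_algebra.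
From mathcomp Require Import all_classical all_reals all_analysis.

Set Implicit Arguments.
Unset Strict Implicit.
Unset Printing Implicit Defensive.

Import Order.TTheory GRing.Theory Num.Theory.
Import numFieldNormedType.Exports.

Local Open Scope classical_set_scope.
Local Open Scope ring_scope.

Record mdp (R : realType) (N : nat) (A : finType) := MDP {
  avail : 'I_N -> {set A};
  trans : 'I_N -> A -> 'I_N -> R;
  cost : 'I_N -> A -> R;
  avail_neq0 : forall s, avail s != finset.set0;
  trans_ge0 : forall s a s', a \in avail s -> 0 <= trans s a s';
  trans_sum1 : forall s a, a \in avail s -> \sum_s' trans s a s' = 1;
  cost_ge0 : forall s a, a \in avail s -> 0 <= cost s a }.

(* The power levels are [power p], [p : 'I_M]; [drop_prob s p] is theta(s,p). *)
Record channel (R : realType) (N M : nat) := Channel {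
  power : 'I_M -> R;
  power_cost : 'I_M -> R;
  drop_prob : 'I_N -> 'I_M -> R;
  power_inj : injective power;
  drop_ge0 : forall s p, 0 <= drop_prob s p;
  drop_lt1 : forall s p, drop_prob s p < 1;
  drop_mono : forall s p q, power p <= power q -> drop_prob s q <= drop_prob s p }.

Section Chains.
Variables (R : realType) (N : nat).
Implicit Types (Q : 'M[R]_N) (C : {set 'I_N}) (pi : 'I_N -> R).

Definition reaches Q (i j : 'I_N) : Prop := exists n : nat, 0 < (Q ^+ n) i j.

(* The equivalence says at once that C is closed and that its states
   communicate. *)
Definition ergodic_class Q C : Prop :=
  C != finset.set0 /\ forall i, i \in C -> forall j, reaches Q i j <-> j \in C.

Definition single_ergodic_class Q : Prop := exists! C, ergodic_class Q C.

(* Only ergodic states are concerned: transient states have no influence. *)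
Definition aperiodic Q : Prop :=
  forall C i, ergodic_class Q C -> i \in C ->
  forall d : nat,
    (forall n : nat, (0 < n)%N -> 0 < (Q ^+ n) i i -> (d %| n)%N) -> d = 1%N.

Definition stationary_dist Q pi : Prop :=
  [/\ forall s, 0 <= pi s, \sum_s pi s = 1 &
      forall s', \sum_s pi s * Q s s' = pi s'].

End Chains.

Section CoDesign.
Variables (R : realType) (N M : nat) (A : finType).
Variables (D : mdp R N A) (W : channel R N M).

(* (s_k, a_k, p_k) *)
Definition stage := ('I_N * A * 'I_M)%type.

(* The completed stages 0, ..., k-1, newest first: h_k is such a sequence of
   length k together with the current state s_k. *)
Definition history := seq stage.

Definition control_policy := history -> 'I_N -> A -> R.
Definition power_policy := history -> 'I_N -> 'I_M -> R.

Definition control_rule (d : 'I_N -> A -> R) : Prop := forall s,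
  [/\ forall a, 0 <= d s a, forall a, a \notin avail D s -> d s a = 0 &
      \sum_a d s a = 1].

Definition power_rule (d : 'I_N -> 'I_M -> R) : Prop := forall s,
  (forall p, 0 <= d s p) /\ \sum_p d s p = 1.

Definition is_control_policy (mm : control_policy) : Prop :=
  forall h, control_rule (mm h).

Definition is_power_policy (mp : power_policy) : Prop :=
  forall h, power_rule (mp h).

Definition stationary_control (d : 'I_N -> A -> R) : control_policy :=
  fun _ => d.

Definition stationary_power (d : 'I_N -> 'I_M -> R) : power_policy :=
  fun _ => d.

Definition rule_matrix (d : 'I_N -> A -> R) : 'M[R]_N :=
  \matrix_(s, s') \sum_(a in avail D s) d s a * trans D s a s'.

(* A decision rule at time k maps the current state to a distribution over its
   available actions; a history-dependent policy induces one at each time, for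
   each fixed past. *)
Definition unichain : Prop :=
  forall (n : nat) (d : nat -> 'I_N -> A -> R), (0 < n)%N ->
  (forall i, control_rule (d i)) ->
  forall k : nat, (1 <= k <= n)%N ->
    let Q := \prod_(1 <= i < k.+1) rule_matrix (d i) in
    aperiodic Q /\ single_ergodic_class Q.

Section Process.
Variables (s0 : 'I_N) (mm : control_policy) (mp : power_policy).

(* Law of the current state given the past. *)
Definition state_law (h : history) (s : 'I_N) : R :=
  if h is x :: _ then trans D x.1.1 x.1.2 s else (s == s0)%:R.

Fixpoint history_prob (h : history) : R :=
  if h is (s, a, p) :: h' then
    history_prob h' * (state_law h' s * mm h' s a * mp h' s p)
  else 1.

(* Expectation of a function of the first T stages. *)
Definition expect (T : nat) (f : T.-tuple stage -> R) : R :=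
  \sum_(h : T.-tuple stage) history_prob h * f h.

(* [thead h] is the stage of index k when h has length k+1. *)
Definition prob_state_power (k : nat) (s : 'I_N) (p : 'I_M) : R :=
  expect (fun h : k.+1.-tuple stage =>
    (((thead h).1.1 == s) && ((thead h).2 == p))%:R).

Definition finite_cost (lambda : R) (T : nat) : R :=
  T%:R^-1 * expect (fun h : T.+1.-tuple stage =>
    \sum_(x <- h) (cost D x.1.1 x.1.2 + lambda * power_cost W x.2)).

Definition average_cost (lambda J : R) : Prop :=
  finite_cost lambda T @[T --> \oo] --> J.

(* For an arbitrary, possibly history-dependent, policy, the stationary
   distribution of (s_k, p_k) is the limit of its mean occupation
   frequencies. *)
Definition joint_stationary (pibar : 'I_N -> 'I_M -> R) : Prop :=
  forall s p,
    T%:R^-1 * \sum_(k < T) prob_state_power k s p @[T --> \oo] --> pibar s p.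

End Process.

Definition drop_rate (X : 'I_N -> 'I_M -> R) : R :=
  \sum_s \sum_p drop_prob W s p * X s p.

Definition safety_bound (rho lambda0 lambda1 : R) : R :=
  (1 - lambda1 * rho) / (rho * (lambda0 - lambda1)).

(* A joint policy competes when its stationary distribution and its average
   cost are defined and the safety constraint holds. *)
Definition admissible (lambda bound : R) (s0 : 'I_N) (mm : control_policy)
    (mp : power_policy) (J : R) : Prop :=
  [/\ is_control_policy mm, is_power_policy mp,
      exists2 pibar, joint_stationary s0 mm mp pibar & drop_rate pibar < bound
    & average_cost s0 mm mp lambda J].

Definition optimal_policy (lambda bound : R) (s0 : 'I_N)
    (mm : control_policy) (mp : power_policy) : Prop :=
  exists2 J, admissible lambda bound s0 mm mp J &
    forall mm' mp' J', admissible lambda bound s0 mm' mp' J' -> J <= J'.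

Definition state_marginal1 (X1 : 'I_N -> A -> R) (s : 'I_N) : R :=
  \sum_(a in avail D s) X1 s a.

Definition state_marginal2 (X2 : 'I_N -> 'I_M -> R) (s : 'I_N) : R :=
  \sum_p X2 s p.

(* X1 and X2 are the distributions of the pairs (s_k, a_k) and (s_k, p_k) of
   one and the same process, so that they have the same state marginal.  The
   constraints of [lp_constraints] do not imply this: taken alone, they do not
   relate X2 to the transition probabilities. *)
Definition same_states (X1 : 'I_N -> A -> R) (X2 : 'I_N -> 'I_M -> R) : Prop :=
  forall s, state_marginal1 X1 s = state_marginal2 X2 s.

Record lp_constraints (bound : R) (X1 : 'I_N -> A -> R)
    (X2 : 'I_N -> 'I_M -> R) : Prop := LpConstraints {
  lp_ge0_1 : forall s a, a \in avail D s -> 0 <= X1 s a;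
  lp_ge0_2 : forall s p, 0 <= X2 s p;
  lp_balance : forall s',
    \sum_(a in avail D s') X1 s' a
      - \sum_s \sum_(a in avail D s) trans D s a s' * X1 s a = 0;
  lp_sum1_1 : \sum_s \sum_(a in avail D s) X1 s a = 1;
  lp_sum1_2 : \sum_s \sum_p X2 s p = 1;
  lp_safety : drop_rate X2 < bound }.

Definition lp_cost (lambda : R) (X1 : 'I_N -> A -> R)
    (X2 : 'I_N -> 'I_M -> R) : R :=
  \sum_s \sum_(a in avail D s) X1 s a * cost D s a
    + lambda * \sum_s \sum_p X2 s p * power_cost W p.

Definition lp_optimal (lambda bound : R) (X1 : 'I_N -> A -> R)
    (X2 : 'I_N -> 'I_M -> R) : Prop :=
  [/\ same_states X1 X2, lp_constraints bound X1 X2 &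
      forall Y1 Y2, same_states Y1 Y2 -> lp_constraints bound Y1 Y2 ->
        lp_cost lambda X1 X2 <= lp_cost lambda Y1 Y2].

(* At the states of zero marginal, where the quotient is 0/0, the policy is
   free: there it follows the decision rule d. *)
Definition lp_control (X1 d : 'I_N -> A -> R) : 'I_N -> A -> R := fun s a =>
  if state_marginal1 X1 s == 0 then d s a
  else if a \in avail D s then X1 s a / state_marginal1 X1 s else 0.

Definition lp_power (X2 d : 'I_N -> 'I_M -> R) : 'I_N -> 'I_M -> R := fun s p =>
  if state_marginal2 X2 s == 0 then d s p
  else X2 s p / state_marginal2 X2 s.

End CoDesign.

(* Main.v *)
(** For a decision rule with a single ergodic class, the averages of the state
    laws converge to the stationary distribution, because [v |-> v Q - v] is
    injective on the vectors of sum 0.  The stationary policy read off an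
    optimal solution (X1, X2) therefore has the cost and the drop rate of
    (X1, X2).  Conversely, any cluster point of the occupation measures of a
    competing history-dependent policy has marginals feasible for the linear
    program, with the cost and the drop rate of that policy; optimality of
    (X1, X2) concludes. *)

Require Import Defs.
From HB Require Import structures.
From mathcomp Require Import all_boot all_order all_algebra.
From mathcomp Require Import all_classical all_reals all_analysis.
From mathcomp Require Import lra.

Set Implicit Arguments.
Unset Strict Implicit.
Unset Printing Implicit Defensive.

Import Order.TTheory GRing.Theory Num.Theory.
Import numFieldNormedType.Exports.

Local Open Scope classical_set_scope.
Local Open Scope ring_scope.

(** * Stochastic matrices with a single ergodic class *)

Section StochasticMatrix.
Variables (R : realType) (N : nat) (Q : 'M[R]_N).
Hypothesis Q_ge0 : forall i j, 0 <= Q i j.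

Lemma expmx_ge0 n i j : 0 <= (Q ^+ n) i j.
Proof.
elim: n i j => [|n IHn] i j; first by rewrite expr0 mxE ler0n.
rewrite exprS mxE; apply: sumr_ge0 => k _.
exact: mulr_ge0.
Qed.

Lemma reaches_refl i : reaches Q i i.
Proof. by exists 0%N; rewrite expr0 mxE eqxx. Qed.

Lemma reaches_trans j i k : reaches Q i j -> reaches Q j k -> reaches Q i k.
Proof.
move=> [m Qij] [n Qjk]; exists (m + n)%N.
rewrite exprD mxE (bigD1 j)//= ltr_pwDl ?mulr_gt0//.
by apply: sumr_ge0 => l _; rewrite mulr_ge0 ?expmx_ge0.
Qed.

(** Among the states reachable from [i], choose [j] with the fewest successors. A successor of [j]
    has its successors among those of [j], hence all of them by minimality, so the successors of [j]
    communicate. *)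
Lemma ergodic_class_reached i :
  exists2 C, ergodic_class Q C & forall j, j \in C -> reaches Q i j.
Proof.
pose succ j := [set k | `[< reaches Q j k >]]%SET.
have succP j k : (k \in succ j) = `[< reaches Q j k >] by rewrite inE.
have ii : i \in succ i by rewrite succP; apply/asboolP/reaches_refl.
case: (@arg_minnP _ i (fun j => j \in succ i) (fun j => #|succ j|) ii) => j.
rewrite succP => /asboolP Qij jmin.
have succ_sub k : reaches Q j k -> succ k \subset succ j.
  move=> Qjk; apply/fintype.subsetP => l; rewrite !succP => /asboolP Qkl.
  exact/asboolP/(reaches_trans Qjk).
exists (succ j); last first.
  by move=> k; rewrite succP => /asboolP; apply: reaches_trans.
split; first by apply/finset.set0Pn; exists j; rewrite succP; apply/asboolP/reaches_refl.
move=> k; rewrite succP => /asboolP Qjk l.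
suff -> : succ j = succ k by rewrite succP; split => [|/asboolP//] /asboolP.
apply/esym/eqP; rewrite eqEcard succ_sub//=; apply: jmin.
by rewrite succP; apply/asboolP/(reaches_trans Qij).
Qed.

Lemma invariant_pow (v : 'rV[R]_N) n : v *m Q = v -> v *m Q ^+ n = v.
Proof.
move=> vQ; elim: n => [|n IHn]; first by rewrite expr0 mulmx1.
by rewrite exprS -mulmxE mulmxA vQ.
Qed.

(** [v] is also invariant under every power of [Q], so [v 0 j] is at least [v 0 i * (Q ^+ n) i j]:
    the support of [v] is closed. *)
Lemma invariant_support (v : 'rV[R]_N) i j : (forall k, 0 <= v 0 k) ->
  v *m Q = v -> 0 < v 0 i -> reaches Q i j -> 0 < v 0 j.
Proof.
move=> v_ge0 vQ vi [n Qij]; rewrite -(invariant_pow n vQ) mxE (bigD1 i)//=.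
rewrite ltr_pwDl ?mulr_gt0// sumr_ge0// => k _.
by rewrite mulr_ge0 ?expmx_ge0.
Qed.

Hypothesis Q_sum1 : forall i, \sum_j Q i j = 1.

Lemma mulmx_stochastic_sum (v : 'rV[R]_N) :
  \sum_j (v *m Q) 0 j = \sum_j v 0 j.
Proof.
under eq_bigr do rewrite mxE.
by rewrite exchange_big; apply: eq_bigr => i _; rewrite -mulr_sumr Q_sum1 mulr1.
Qed.

(** The triangle inequality gives [w <= w *m Q] entrywise for the vector [w] of absolute values; [Q]
    preserves sums, so no entry can be strictly smaller. *)
Lemma invariant_norm (v : 'rV[R]_N) : v *m Q = v ->
  (map_mx Num.norm v) *m Q = map_mx Num.norm v.
Proof.
move=> vQ; set w := map_mx _ v.
have le_w j : 0 <= (w *m Q) 0 j - w 0 j.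
  rewrite subr_ge0 {1}/w mxE -{1}vQ !mxE (le_trans (ler_norm_sum _ _ _))//.
  by apply: ler_sum => i _; rewrite normrM !mxE (ger0_norm (Q_ge0 _ _)).
apply/rowP => j; apply/eqP; rewrite -subr_eq0; apply/eqP.
apply: (@psumr_eq0P _ _ xpredT _ (fun k _ => le_w k)) => //.
by rewrite sumrB mulmx_stochastic_sum subrr.
Qed.

Hypothesis Q_single : single_ergodic_class Q.

(* The positive and negative parts of an invariant vector are invariant with
   disjoint closed supports, while every nonempty closed set contains the
   single ergodic class. *)
Lemma invariant_sum0 (v : 'rV[R]_N) :
  v *m Q = v -> \sum_i v 0 i = 0 -> v = 0.
Proof.
move=> vQ v0; have [C [C_erg C_uniq]] := Q_single.
pose w := map_mx Num.norm v; have wQ : w *m Q = w := invariant_norm vQ.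
have /finset.set0Pn[c cC] : C != finset.set0 by case: C_erg.
have pos (u : 'rV[R]_N) : (forall k, 0 <= u 0 k) -> u *m Q = u -> u 0 c = 0 ->
    forall i, u 0 i = 0.
  move=> u_ge0 uQ uc i; apply/eqP; apply: contraTT isT => ui.
  have ui_gt0 : 0 < u 0 i by rewrite lt_neqAle eq_sym ui u_ge0.
  have [C' C'_erg C'i] := ergodic_class_reached i.
  have CC' := C_uniq _ C'_erg; rewrite -CC' in C'i.
  by have := invariant_support u_ge0 uQ ui_gt0 (C'i _ cC); rewrite uc ltxx.
(* [w - v] and [w + v] are twice the negative and the positive part of [v]. Both have the same sum
   as [w], so if one of them is zero, the absolute values of [v] sum to 0. *)
have sub0 (u : 'rV[R]_N) : u = w - v \/ u = w + v -> (forall i, u 0 i = 0) -> v = 0.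
  move=> uE u0; have w0 : \sum_i w 0 i = 0.
    transitivity (\sum_i u 0 i); last by rewrite big1.
    case: uE => ->.
      transitivity (\sum_i w 0 i - \sum_i v 0 i); first by rewrite v0 subr0.
      by rewrite -sumrB; apply: eq_bigr => i _; rewrite !mxE.
    transitivity (\sum_i w 0 i + \sum_i v 0 i); first by rewrite v0 addr0.
    by rewrite -big_split /=; apply: eq_bigr => i _; rewrite !mxE.
  apply/rowP => i; apply/eqP; rewrite mxE -normr_eq0; apply/eqP.
  have := @psumr_eq0P _ _ xpredT (fun i => w 0 i) _ w0 i isT.
  by rewrite mxE => -> // k _; rewrite mxE.
(* The sign of [v] at [c] decides which part vanishes at [c], hence everywhere by [pos]. *)
have [vc|vc] := lerP 0 (v 0 c).
- apply: (sub0 (w - v)); first by left.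
  apply: pos.
  + by move=> k; rewrite !mxE subr_ge0 ler_norm.
  + by rewrite mulmxBl wQ vQ.
  + by rewrite !mxE ger0_norm ?subrr.
- apply: (sub0 (w + v)); first by right.
  apply: pos.
  + by move=> k; rewrite !mxE -lerBlDr sub0r -normrN ler_norm.
  + by rewrite mulmxDl wQ vQ.
  + by rewrite !mxE ltr0_norm ?addNr.
Qed.

(** A linear inverse of [v |-> v Q - v] on the vectors of sum 0: it turns a small invariance defect
    into a small vector. *)
Lemma stochastic_resolvent : exists B : 'M[R]_N, forall v : 'rV[R]_N,
  \sum_i v 0 i = 0 -> v = (v *m Q - v) *m B.
Proof.
(* The all-ones matrix kills the vectors of sum 0, so [K] acts on them as [Q - 1], and adding it
   makes the whole matrix invertible. *)
pose K : 'M[R]_N := Q - 1%:M + const_mx 1.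
have vK (v : 'rV[R]_N) : v *m K = v *m Q - v + const_mx (\sum_i v 0 i).
  rewrite mulmxDr mulmxBr mulmx1; congr (_ + _); apply/rowP => j; rewrite !mxE.
  by apply: eq_bigr => i _; rewrite mxE mulr1.
have K_unit : K \in unitmx.
  rewrite -row_free_unit; apply: inj_row_free => v; rewrite vK => v0.
  have v_sum : \sum_i v 0 i = 0.
    have [N0|N0] := posnP N.
      rewrite big1// => i _; exfalso.
      by have := leq_ltn_trans (leq0n i) (ltn_ord i); rewrite N0.
    (* The entries of [v *m Q - v] sum to 0, which leaves [N] times the sum of [v]. *)
    have : \sum_j (v *m Q - v + const_mx (\sum_i v 0 i)) 0 j = 0.
      by rewrite v0 big1// => j _; rewrite mxE.
    rewrite (eq_bigr (fun j => (v *m Q) 0 j - v 0 j + \sum_i v 0 i)); last first.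
      by move=> j _; rewrite !mxE.
    rewrite big_split /= sumrB mulmx_stochastic_sum subrr add0r sumr_const card_ord.
    by move/eqP; rewrite mulrn_eq0 => /orP[/eqP N00|/eqP//]; rewrite N00 in N0.
  apply: invariant_sum0 => //; apply/eqP; rewrite -subr_eq0 -v0 v_sum.
  by apply/eqP/rowP => j; rewrite !mxE addr0.
exists (invmx K) => v v_sum; rewrite -[LHS](mulmxK K_unit) vK v_sum.
by congr (_ *m _); apply/rowP => j; rewrite !mxE addr0.
Qed.

End StochasticMatrix.

(** * Limits of linear functionals and of averages *)

Section Limits.
Variables (R : realType).

Lemma cvg_linear (T : Type) (F : set_system T) (I : finType)
    (u : T -> I -> R) (l c : I -> R) : Filter F ->
  (forall i, u t i @[t --> F] --> l i) ->
  \sum_i c i * u t i @[t --> F] --> \sum_i c i * l i.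
Proof.
move=> FF ul; apply: (@cvg_big R I +%R 0 xpredT (@add_continuous R)) => i _.
by apply: cvgMl_tmp; exact: ul.
Qed.

(** The cube is compact, so [u] has a cluster point [l]; every linear functional that converges
    along [u] takes its limit value at [l]. *)
Lemma cluster_linear (I : finType) (u : nat -> I -> R) :
  (forall n i, 0 <= u n i <= 1) ->
  exists2 l : I -> R, (forall i, 0 <= l i) &
    forall (c : I -> R) (L : R),
      \sum_i c i * u n i @[n --> \oo] --> L -> \sum_i c i * l i = L.
Proof.
move=> u01.
have [l [l01]] := @tychonoff I (fun=> R) (fun=> `[0, 1]%classic)
  (fun=> @segment_compact R 0 1) (u @ \oo) _ (filterE _ u01).
(* [G] is a proper filter that refines the image of the sequence and converges to [l]. Both
   candidate limits of the functional hold along [G], so they agree. *)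
rewrite cluster_cvgE => -[G PG [Gl uG]].
exists l => [i|c L uL]; first by have := l01 i; rewrite /= in_itv => /andP[].
have cG : \sum_i c i * f i @[f --> G] --> \sum_i c i * l i.
  apply: cvg_linear => i; apply: cvg_trans;
    last exact: (@proj_continuous I (fun=> R) i l).
  exact: cvg_app Gl.
have LG : \sum_i c i * f i @[f --> G] --> L.
  move=> A LA; apply: (uG [set f | A (\sum_i c i * f i)]); exact: (uL A LA).
exact: (cvg_unique _ cG LG).
Qed.

Lemma cvg_invn_bounded (b : nat -> R) (K : R) : (forall n, `|b n| <= K) ->
  n%:R^-1 * b n @[n --> \oo] --> 0.
Proof.
move=> bK; have K0 : (n%:R^-1 : R) * K @[n --> \oo] --> 0.
  rewrite -[X in _ --> X](mul0r K); apply: cvgMr_tmp.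
  rewrite -(cvg_shiftS (fun n : nat => n%:R^-1 : R)).
  exact: cvg_harmonic.
have NK0 : - ((n%:R^-1 : R) * K) @[n --> \oo] --> 0.
  by rewrite -[X in _ --> X]oppr0; apply: cvgN.
apply: (squeeze_cvgr _ NK0 K0).
near=> n; rewrite -ler_norml normrM ger0_norm ?invr_ge0//.
by rewrite ler_wpM2l ?invr_ge0.
Unshelve. all: by end_near. Qed.

End Limits.

(** For [T > 0] the vector [v T - pi] has sum 0, so the resolvent writes it as a fixed linear image
    of the defect [v T *m Q - v T], which tends to 0. *)
Lemma cesaro_invariant (R : realType) (N : nat) (Q : 'M[R]_N)
    (v : nat -> 'rV[R]_N) (pi : 'rV[R]_N) :
  (forall i j, 0 <= Q i j) -> (forall i, \sum_j Q i j = 1) ->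
  single_ergodic_class Q -> pi *m Q = pi -> \sum_i pi 0 i = 1 ->
  (forall T, (0 < T)%N -> \sum_i v T 0 i = 1) ->
  (forall j, (v T *m Q - v T) 0 j @[T --> \oo] --> 0) ->
  forall i, v T 0 i @[T --> \oo] --> pi 0 i.
Proof.
move=> Q_ge0 Q_sum1 Q1 piQ pi1 v1 vQ i.
have [B BP] := stochastic_resolvent Q_ge0 Q_sum1 Q1.
have lim0 : \sum_j B j i * (v T *m Q - v T) 0 j @[T --> \oo] --> 0.
  rewrite [X in _ --> X](_ : 0 = \sum_j B j i * 0).
    exact: (@cvg_linear R nat \oo 'I_N (fun T j => (v T *m Q - v T) 0 j) (fun=> 0)).
  by rewrite big1// => j _; rewrite mulr0.
have limpi : pi 0 i + \sum_j B j i * (v T *m Q - v T) 0 j @[T --> \oo] --> pi 0 i.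
  by rewrite -[X in _ --> X]addr0; apply: cvgD lim0; apply: cvg_cst.
apply: cvg_trans limpi; apply: near_eq_cvg; near=> T.
have T0 : (0 < T)%N by near: T; exists 1%N.
have := BP (v T - pi).
rewrite (_ : (v T - pi) *m Q - (v T - pi) = v T *m Q - v T); last first.
  by rewrite mulmxBl piQ opprB addrA subrK.
move=> vB; transitivity (pi 0 i + (v T - pi) 0 i); last by rewrite !mxE [LHS]addrC subrK.
congr (_ + _); rewrite vB; last first.
  under eq_bigr do rewrite !mxE.
  by rewrite sumrB v1// pi1 subrr.
by rewrite [RHS]mxE; apply: eq_bigr => j _; rewrite mulrC.
Unshelve. all: by end_near. Qed.

(** * The process under history-dependent policies: stage laws and occupation measures *)

Lemma sum_tupleS (V : nmodType) (I : finType) (k : nat)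
    (F : k.+1.-tuple I -> V) :
  \sum_h F h = \sum_(h : k.-tuple I) \sum_x F (cons_tuple x h).
Proof.
rewrite pair_big /= (reindex (fun p : k.-tuple I * I => cons_tuple p.2 p.1))//=.
exists (fun h => (behead_tuple h, thead h)) => [[h x] _|h _] /=.
  by congr (_, _); apply: val_inj.
by rewrite [RHS]tuple_eta; apply: val_inj.
Qed.

Section Process.
Variables (R : realType) (N M : nat) (A : finType) (D : mdp R N A).
Local Notation stage := (stage N M A).

Lemma sum_stage (F : stage -> R) :
  \sum_x F x = \sum_s \sum_a \sum_p F (s, a, p).
Proof. by rewrite pair_big pair_big; apply: eq_bigr => -[[s a] p]. Qed.

Lemma sum_stage_avail (l : stage -> R) (g : 'I_N -> A -> R) :
  (forall s a p, a \notin avail D s -> l (s, a, p) = 0) ->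
  \sum_x g x.1.1 x.1.2 * l x =
  \sum_s \sum_(a in avail D s) g s a * \sum_p l (s, a, p).
Proof.
move=> l0; rewrite sum_stage; apply: eq_bigr => s _.
rewrite (bigID (mem (avail D s)))/= [X in _ + X]big1 ?addr0.
  by apply: eq_bigr => a _; rewrite mulr_sumr.
by move=> a aD; rewrite big1// => p _; rewrite l0 ?mulr0.
Qed.

Lemma sum_stage_power (l : stage -> R) (g : 'I_N -> 'I_M -> R) :
  \sum_x g x.1.1 x.2 * l x = \sum_s \sum_p g s p * \sum_a l (s, a, p).
Proof.
rewrite sum_stage; apply: eq_bigr => s _.
by rewrite exchange_big; apply: eq_bigr => p _; rewrite mulr_sumr.
Qed.

(** The stage cost is a function of (s, a) plus a function of the power, so only the two pair
    marginals of [l] enter. *)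
Lemma lp_cost_joint (W : channel R N M) (lambda : R) (l : stage -> R) :
  (forall s a p, a \notin avail D s -> l (s, a, p) = 0) ->
  \sum_x (cost D x.1.1 x.1.2 + lambda * power_cost W x.2) * l x =
  lp_cost D W lambda (fun s a => \sum_p l (s, a, p))
    (fun s p => \sum_a l (s, a, p)).
Proof.
move=> l0; under eq_bigr do rewrite mulrDl.
rewrite big_split /=; congr (_ + _).
  rewrite (sum_stage_avail (cost D) l0).
  by apply: eq_bigr => s _; apply: eq_bigr => a _; rewrite mulrC.
rewrite (sum_stage_power l (fun _ p => lambda * power_cost W p)) mulr_sumr.
apply: eq_bigr => s _; rewrite mulr_sumr; apply: eq_bigr => p _.
by rewrite -mulrA; congr (_ * _); rewrite mulrC.
Qed.

Variables (s0 : 'I_N) (mm : control_policy R N M A) (mp : power_policy R N M A).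
Hypotheses (mmP : is_control_policy D mm) (mpP : is_power_policy mp).

Local Notation hprob := (history_prob D s0 mm mp).
Local Notation law := (state_law D s0).

(** The conditional law of the next stage given the past [h]; action and power are drawn
    independently given [h] and the current state. *)
Definition stage_weight (h : seq stage) (x : stage) : R :=
  law h x.1.1 * mm h x.1.1 x.1.2 * mp h x.1.1 x.2.

Definition stage_law (k : nat) (x : stage) : R :=
  \sum_(h : k.-tuple stage) hprob h * stage_weight h x.

(** The mean occupation measure of the first [T] stages; it is zero for [T = 0]. *)
Definition occupation (T : nat) (x : stage) : R :=
  T%:R^-1 * \sum_(k < T) stage_law k x.

Lemma history_prob_cons x h : hprob (x :: h) = hprob h * stage_weight h x.
Proof. by case: x => [[s a] p]. Qed.

(** The two bounds go through one induction: [law] is known to be nonnegative only after an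
    available action, and after any other action the factor [hprob h] is 0. *)
Lemma history_state_ge0 h s : 0 <= hprob h /\ 0 <= hprob h * law h s.
Proof.
elim: h s => [|x h IHh] s; first by rewrite /= mul1r ler01 ler0n.
have [mm_ge0 mm_out _] := mmP h x.1.1; have [mp_ge0 _] := mpP h x.1.1.
have h_ge0 : 0 <= hprob (x :: h).
  rewrite history_prob_cons /stage_weight !mulrA; have [_ hs_ge0] := IHh x.1.1.
  by do 2![apply: mulr_ge0 => //].
split=> //; case: (boolP (x.1.2 \in avail D x.1.1)) => xD.
  by rewrite mulr_ge0// trans_ge0.
by rewrite history_prob_cons /stage_weight mm_out// mulr0 !mul0r mulr0 mul0r.
Qed.

Lemma history_state_sum h : hprob h * \sum_s law h s = hprob h.
Proof.
case: h => [|x h].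
  by rewrite /= mul1r (bigD1 s0)//= eqxx big1 ?addr0// => s /negbTE ->.
case: (boolP (x.1.2 \in avail D x.1.1)) => xD; first by rewrite trans_sum1// mulr1.
have [_ mm_out _] := mmP h x.1.1.
by rewrite history_prob_cons /stage_weight mm_out// mulr0 !mul0r mulr0 mul0r.
Qed.

Lemma stage_weight_sum h s :
  \sum_a \sum_p stage_weight h (s, a, p) = law h s.
Proof.
have [_ _ mm1] := mmP h s; have [_ mp1] := mpP h s.
rewrite -[RHS]mulr1 -mm1 mulr_sumr; apply: eq_bigr => a _.
by rewrite -[RHS]mulr1 -mp1 mulr_sumr.
Qed.

Lemma expectS k (f : k.+1.-tuple stage -> R) : expect D s0 mm mp f =
  \sum_(h : k.-tuple stage) hprob h *
    \sum_x stage_weight h x * f (cons_tuple x h).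
Proof.
rewrite /expect sum_tupleS; apply: eq_bigr => h _; rewrite mulr_sumr.
by apply: eq_bigr => x _; rewrite mulrA -history_prob_cons.
Qed.

Lemma expect_thead k (g : stage -> R) :
  expect D s0 mm mp (fun h : k.+1.-tuple stage => g (thead h)) =
  \sum_x g x * stage_law k x.
Proof.
rewrite expectS; under [RHS]eq_bigr do rewrite mulr_sumr.
rewrite exchange_big; apply: eq_bigr => h _; rewrite mulr_sumr.
by apply: eq_bigr => x _; rewrite theadE mulrA mulrC.
Qed.

Lemma history_weight_sum h :
  hprob h * \sum_x stage_weight h x = hprob h.
Proof.
rewrite sum_stage -[RHS]history_state_sum; congr (_ * _).
by apply: eq_bigr => s _; rewrite stage_weight_sum.
Qed.

Lemma expect_sum T (g : stage -> R) :
  expect D s0 mm mp (fun h : T.-tuple stage => \sum_(x <- h) g x) =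
  \sum_(k < T) \sum_x g x * stage_law k x.
Proof.
elim: T => [|T IHT].
  by rewrite big_ord0 /expect big1// => h _; rewrite tuple0 big_nil mulr0.
rewrite big_ord_recr /= -IHT -expect_thead !expectS /expect -big_split /=.
(* Multiplied by [hprob h], the weights of the newest stage sum to [hprob h], so the sum over the
   older stages can be spread over them. *)
apply: eq_bigr => h _; rewrite -{2}history_weight_sum -mulrA -mulrDr mulr_suml.
congr (_ * _); rewrite -big_split /=; apply: eq_bigr => x _.
by rewrite -mulrDr theadE big_cons addrC.
Qed.

Lemma stage_law_ge0 k x : 0 <= stage_law k x.
Proof.
apply: sumr_ge0 => h _; rewrite /stage_weight !mulrA.
have [mm_ge0 _ _] := mmP h x.1.1; have [mp_ge0 _] := mpP h x.1.1.
have [_ hs_ge0] := history_state_ge0 h x.1.1.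
by do 2![apply: mulr_ge0 => //].
Qed.

Lemma stage_law_unavail k s a p : a \notin avail D s ->
  stage_law k (s, a, p) = 0.
Proof.
move=> aD; apply: big1 => h _; have [_ mm_out _] := mmP h s.
by rewrite /stage_weight /= mm_out// mulr0 mul0r mulr0.
Qed.

Lemma stage_law_sum k : \sum_x stage_law k x = 1.
Proof.
have -> : \sum_x stage_law k x = \sum_(h : k.-tuple stage) hprob h.
  rewrite exchange_big; apply: eq_bigr => h _.
  by rewrite -mulr_sumr history_weight_sum.
elim: k => [|k IHk].
  by rewrite (bigD1 [tuple])//= big1 ?addr0// => h; rewrite tuple0.
rewrite sum_tupleS -IHk; apply: eq_bigr => h _.
by under eq_bigr do rewrite history_prob_cons; rewrite -mulr_sumr history_weight_sum.
Qed.

Lemma stage_law_le1 k x : stage_law k x <= 1.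
Proof.
rewrite -(stage_law_sum k) (bigD1 x)//= lerDl.
by apply: sumr_ge0 => y _; apply: stage_law_ge0.
Qed.

Definition state_prob k s : R := \sum_(h : k.-tuple stage) hprob h * law h s.

Lemma state_prob_marginal k s :
  \sum_a \sum_p stage_law k (s, a, p) = state_prob k s.
Proof.
under eq_bigr do rewrite exchange_big; rewrite exchange_big.
apply: eq_bigr => h _; rewrite -stage_weight_sum mulr_sumr.
by apply: eq_bigr => a _; rewrite mulr_sumr.
Qed.

Lemma state_prob_sum k : \sum_s state_prob k s = 1.
Proof.
rewrite -(stage_law_sum k) sum_stage; apply: eq_bigr => s _.
by rewrite state_prob_marginal.
Qed.

Lemma state_probS k s :
  state_prob k.+1 s = \sum_x trans D x.1.1 x.1.2 s * stage_law k x.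
Proof.
rewrite /state_prob sum_tupleS; under [RHS]eq_bigr do rewrite mulr_sumr.
rewrite [RHS]exchange_big; apply: eq_bigr => h _; apply: eq_bigr => x _.
by rewrite history_prob_cons mulrC.
Qed.

Lemma state_prob_le1 k s : 0 <= state_prob k s <= 1.
Proof.
have ge0 s' : 0 <= state_prob k s'.
  by apply: sumr_ge0 => h _; case: (history_state_ge0 h s').
rewrite ge0 -(state_prob_sum k) (bigD1 s)//= lerDl.
by apply: sumr_ge0.
Qed.

Lemma occupation_linear T (g : stage -> R) :
  \sum_x g x * occupation T x =
  T%:R^-1 * \sum_(k < T) \sum_x g x * stage_law k x.
Proof.
rewrite exchange_big mulr_sumr; apply: eq_bigr => x _.
by rewrite /occupation mulrCA mulr_sumr.
Qed.

Lemma occupation_bounds T x : 0 <= occupation T x <= 1.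
Proof.
have [->|T0] := posnP T; first by rewrite /occupation invr0 mul0r lexx ler01.
rewrite mulr_ge0 ?invr_ge0 ?sumr_ge0//=; last by move=> k _; apply: stage_law_ge0.
rewrite /occupation mulrC ler_pdivrMr ?ltr0n// mul1r -[leRHS]/(T%:R).
rewrite -[in leRHS](card_ord T) -sumr_const ler_sum// => k _.
exact: stage_law_le1.
Qed.

Lemma occupation_sum T : (0 < T)%N -> \sum_x occupation T x = 1.
Proof.
move=> T0; rewrite -[LHS](eq_bigr _ (fun x _ => mul1r _)).
rewrite (occupation_linear T (fun=> 1)).
under eq_bigr do under eq_bigr do rewrite mul1r.
under eq_bigr do rewrite stage_law_sum.
by rewrite sumr_const card_ord mulVf ?pnatr_eq0 -?lt0n.
Qed.

Lemma occupation_unavail T s a p : a \notin avail D s ->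
  occupation T (s, a, p) = 0.
Proof.
by move=> aD; rewrite /occupation big1 ?mulr0// => k _; apply: stage_law_unavail.
Qed.

(** The averaged flow out of [s] minus the flow into [s] telescopes to the difference of the state
    laws at times 0 and [T], divided by [T]. *)
Lemma occupation_balance s :
  \sum_x ((x.1.1 == s)%:R - trans D x.1.1 x.1.2 s) * occupation T x
    @[T --> \oo] --> 0.
Proof.
have -> : (fun T => \sum_x ((x.1.1 == s)%:R - trans D x.1.1 x.1.2 s) *
     occupation T x) =
   (fun T => T%:R^-1 * (state_prob 0 s - state_prob T s)).
  apply/funext => T; rewrite occupation_linear; congr (_ * _).
  rewrite -opprB -(telescope_sumr (state_prob^~ s) (leq0n T)) big_mkord -sumrN.
  apply: eq_bigr => k _; rewrite opprB state_probS -state_prob_marginal.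
  under eq_bigr do rewrite mulrBl.
  rewrite sumrB; congr (_ - _); rewrite sum_stage (bigD1 s)//= addrC big1 ?add0r.
    apply: eq_bigr => a _; apply: eq_bigr => p _.
    by rewrite /= eqxx mul1r.
  move=> s' /negbTE s's; rewrite big1// => a _; rewrite big1// => p _.
  by rewrite /= s's mul0r.
apply: (@cvg_invn_bounded _ _ 1) => T.
have /andP[a0 a1] := state_prob_le1 0 s; have /andP[b0 b1] := state_prob_le1 T s.
by rewrite ler_norml; apply/andP; split; lra.
Qed.

(** This puts the stationary distribution in the form that [cluster_linear] accepts: limits of
    linear functionals of the occupation measures. *)
Lemma occupation_power pibar : joint_stationary D s0 mm mp pibar <->
  forall s p, \sum_x ((x.1.1 == s) && (x.2 == p))%:R * occupation T x
    @[T --> \oo] --> pibar s p.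
Proof.
suff eqf s p : (fun T => T%:R^-1 * \sum_(k < T) prob_state_power D s0 mm mp k s p) =
    (fun T => \sum_x ((x.1.1 == s) && (x.2 == p))%:R * occupation T x).
  by split=> H s p; have := H s p; rewrite eqf.
apply/funext => T; rewrite occupation_linear; congr (_ * _).
apply: eq_bigr => k _.
exact: (expect_thead k (fun x => ((x.1.1 == s) && (x.2 == p))%:R)).
Qed.

Lemma occupation_cost (W : channel R N M) lambda J :
  average_cost D W s0 mm mp lambda J <->
  \sum_x (cost D x.1.1 x.1.2 + lambda * power_cost W x.2) * occupation T x
    @[T --> \oo] --> J.
Proof.
pose g (x : stage) := cost D x.1.1 x.1.2 + lambda * power_cost W x.2.
(* The cost sums [T + 1] stages but divides by [T]; [b T] is the expected cost of the extra last
   stage, bounded and hence negligible after division. *)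
pose b T := \sum_x g x * stage_law T x.
have costE T : finite_cost D W s0 mm mp lambda T =
    \sum_x g x * occupation T x + T%:R^-1 * b T.
  by rewrite /finite_cost (expect_sum T.+1 g) big_ord_recr /= mulrDr occupation_linear.
have b0 : T%:R^-1 * b T @[T --> \oo] --> 0.
  apply: (@cvg_invn_bounded _ _ (\sum_x `|g x|)) => T.
  rewrite (le_trans (ler_norm_sum _ _ _))// ler_sum// => x _.
  by rewrite normrM (ger0_norm (stage_law_ge0 _ _)) ler_piMr// stage_law_le1.
split=> [HJ|HJ].
  have -> : (fun T => \sum_x g x * occupation T x) =
      (fun T => finite_cost D W s0 mm mp lambda T - T%:R^-1 * b T).
    by apply/funext => T; rewrite costE addrK.
  by rewrite -[X in _ --> X]subr0; apply: cvgB.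
rewrite /average_cost (funext costE : finite_cost _ _ _ _ _ _ = _).
by rewrite -[X in _ --> X]addr0; apply: cvgD.
Qed.

End Process.

(** * Convergence of the occupation measures under stationary policies *)

Section StationaryPolicies.
Variables (R : realType) (N M : nat) (A : finType) (D : mdp R N A).
Variables (s0 : 'I_N) (d1 : 'I_N -> A -> R) (d2 : 'I_N -> 'I_M -> R).
Hypotheses (d1P : control_rule D d1) (d2P : power_rule d2).

Lemma rule_matrix_ge0 i j : 0 <= rule_matrix D d1 i j.
Proof.
have [d1_ge0 _ _] := d1P i; rewrite mxE; apply: sumr_ge0 => a aD.
by rewrite mulr_ge0// trans_ge0.
Qed.

Lemma rule_matrix_sum1 i : \sum_j rule_matrix D d1 i j = 1.
Proof.
have [_ d1_out d1_sum] := d1P i.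
under eq_bigr do rewrite mxE.
rewrite exchange_big -d1_sum [RHS](bigID (mem (avail D i)))/=.
rewrite [X in _ = _ + X]big1 ?addr0; last by move=> a /d1_out.
by apply: eq_bigr => a aD; rewrite -mulr_sumr trans_sum1// mulr1.
Qed.

Lemma rule_matrix_unichain : unichain D -> single_ergodic_class (rule_matrix D d1).
Proof.
move=> /(_ 1%N (fun=> d1) isT (fun=> d1P) 1%N isT) [_].
by rewrite big_nat1.
Qed.

Local Notation mm := (stationary_control d1 : control_policy R N M A).
Local Notation mp := (stationary_power d2 : power_policy R N M A).

Lemma stationary_stage_law k x : stage_law D s0 mm mp k x =
  state_prob D s0 mm mp k x.1.1 * d1 x.1.1 x.1.2 * d2 x.1.1 x.2.
Proof. by rewrite !mulr_suml; apply: eq_bigr => h _; rewrite !mulrA. Qed.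

Lemma stationary_state_probS k s : state_prob D s0 mm mp k.+1 s =
  \sum_s' state_prob D s0 mm mp k s' * rule_matrix D d1 s' s.
Proof.
rewrite state_probS sum_stage; apply: eq_bigr => s' _.
have [_ d1_out _] := d1P s'; have [_ d2_sum] := d2P s'.
rewrite mxE mulr_sumr (bigID (mem (avail D s')))/=.
rewrite [X in _ + X]big1 ?addr0; last first.
  move=> a aD; apply: big1 => p _.
  by rewrite stationary_stage_law /= d1_out// mulr0 mul0r mulr0.
apply: eq_bigr => a _; rewrite -mulr_sumr mulrC mulrA; congr (_ * _).
under eq_bigr do rewrite stationary_stage_law /=.
by rewrite -mulr_sumr d2_sum mulr1.
Qed.

(** The decision rules do not depend on time, so they factor out of the average; what remains is the
    averaged state law, to which [cesaro_invariant] applies. *)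
Lemma stationary_occupation_cvg (pi : 'I_N -> R) (x : stage N M A) :
  unichain D -> stationary_dist (rule_matrix D d1) pi ->
  occupation D s0 mm mp T x @[T --> \oo] -->
    pi x.1.1 * d1 x.1.1 x.1.2 * d2 x.1.1 x.2.
Proof.
move=> uni [_ pi_sum piQ]; pose q := state_prob D s0 mm mp.
pose v T : 'rV[R]_N := \row_s (T%:R^-1 * \sum_(k < T) q k s).
have occE T : occupation D s0 mm mp T x = v T 0 x.1.1 * d1 x.1.1 x.1.2 * d2 x.1.1 x.2.
  rewrite mxE -!mulrA; congr (_ * _); rewrite mulr_suml.
  by apply: eq_bigr => k _; rewrite stationary_stage_law mulrA.
rewrite (funext occE : occupation D s0 mm mp ^~ x = _).
apply: cvgMr_tmp; apply: cvgMr_tmp.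
have -> : pi x.1.1 = (\row_s pi s) 0 x.1.1 by rewrite mxE.
have mmP : is_control_policy D mm by move=> h; apply: d1P.
have mpP : is_power_policy mp by move=> h; apply: d2P.
apply: (cesaro_invariant rule_matrix_ge0 rule_matrix_sum1) => //.
- exact: rule_matrix_unichain.
- by apply/rowP => s; rewrite !mxE -[RHS]piQ; apply: eq_bigr => s' _; rewrite mxE.
- by rewrite -pi_sum; apply: eq_bigr => s _; rewrite mxE.
- move=> T T0; under eq_bigr do rewrite mxE.
  rewrite -mulr_sumr exchange_big /=.
  under eq_bigr do rewrite (state_prob_sum s0 mmP mpP).
  by rewrite sumr_const card_ord mulVf ?pnatr_eq0 -?lt0n.
move=> s.
(* Applying the matrix shifts the averaged state laws by one step, so the defect telescopes. *)
have -> : (fun T => (v T *m rule_matrix D d1 - v T) 0 s) =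
    (fun T => T%:R^-1 * (q T s - q 0 s)).
  apply/funext => T; rewrite !mxE -(telescope_sumr (q^~ s) (leq0n T)) big_mkord.
  rewrite sumrB mulrBr; congr (_ - _).
  under [in RHS]eq_bigr do rewrite /q stationary_state_probS.
  rewrite [in RHS]exchange_big mulr_sumr; apply: eq_bigr => s' _.
  by rewrite mxE -mulrA mulr_suml.
apply: (@cvg_invn_bounded _ _ 1) => T.
have /andP[a0 a1] := state_prob_le1 s0 mmP mpP 0 s.
have /andP[b0 b1] := state_prob_le1 s0 mmP mpP T s.
by rewrite ler_norml /q; apply/andP; split; lra.
Qed.

End StationaryPolicies.

(** * From competing policies to feasible points of the linear program *)

Section Optimality.
Variables (R : realType) (N M : nat) (A : finType).
Variables (D : mdp R N A) (W : channel R N M) (lambda bound : R).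

(* The limit of the occupation measures need not exist, but any cluster point
   has the prescribed cost and power marginal, and satisfies the balance
   equations. *)
Lemma admissible_lp_feasible s0 mm mp J : admissible D W lambda bound s0 mm mp J ->
  exists Y1 Y2, [/\ same_states D Y1 Y2, lp_constraints D W bound Y1 Y2 &
    lp_cost D W lambda Y1 Y2 = J].
Proof.
move=> [mmP mpP [pibar /occupation_power pibarP drop]
  /(occupation_cost s0 mmP mpP) costJ].
have [l l_ge0 lP] := cluster_linear (occupation_bounds s0 mmP mpP).
(* Evaluation at a point is written as a linear functional, so that [lP] applies to it. *)
have pointP s a p : \sum_x (x == (s, a, p))%:R * l x = l (s, a, p).
  rewrite (bigD1 (s, a, p))//= eqxx mul1r big1 ?addr0// => x /negbTE ->.
  by rewrite mul0r.
have l_out s a p : a \notin avail D s -> l (s, a, p) = 0.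
  move=> aD; rewrite -pointP; apply: lP.
  rewrite (_ : (fun _ => _) = (fun=> 0)); first exact: cvg_cst.
  apply/funext => T; rewrite big1// => x _.
  case: eqP => [->|]; last by rewrite mul0r.
  by rewrite occupation_unavail ?mulr0.
have l_sum : \sum_x 1 * l x = 1.
  apply: lP; apply: cvg_trans (@cvg_cst _ _ nat \oo _).
  apply: near_eq_cvg; near=> T; under eq_bigr do rewrite mul1r.
  by rewrite occupation_sum//; near: T; exists 1%N.
(* The power marginal is the prescribed [pibar] at every cluster point, so the strict safety
   inequality carries over to [Y2]. *)
have l_power s p : \sum_a l (s, a, p) = pibar s p.
  rewrite -(lP _ _ (pibarP s p)).
  rewrite (sum_stage_power l (fun s' p' => ((s' == s) && (p' == p))%:R)).
  rewrite (bigD1 s)//= [X in _ = _ + X]big1 ?addr0; last first.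
    by move=> s' /negbTE s's; rewrite big1// => p' _; rewrite s's mul0r.
  rewrite (bigD1 p)//= !eqxx mul1r [X in _ = _ + X]big1 ?addr0//.
  by move=> p' /negbTE ->; rewrite andbF mul0r.
have l_balance s := lP _ _ (occupation_balance s0 mmP mpP s).
(* Two marginals of one measure, whence their common state marginal. *)
pose Y1 s a := \sum_p l (s, a, p); pose Y2 s p := \sum_a l (s, a, p).
have Y1_marginal s : state_marginal1 D Y1 s = \sum_a Y1 s a.
  rewrite [RHS](bigID (mem (avail D s)))/= [X in _ = _ + X]big1 ?addr0//.
  by move=> a aD; apply: big1 => p _; apply: l_out.
exists Y1, Y2; split; last by rewrite -(lp_cost_joint W lambda l_out) (lP _ _ costJ).
  by move=> s; rewrite Y1_marginal /Y1 /state_marginal2 exchange_big.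
split.
- by move=> s a _; apply: sumr_ge0.
- by move=> s p; apply: sumr_ge0.
- move=> s; rewrite -[RHS](l_balance s).
  rewrite (sum_stage_avail (fun s' a => (s' == s)%:R - trans D s' a s) l_out).
  under [in RHS]eq_bigr do under eq_bigr do rewrite mulrBl.
  under [in RHS]eq_bigr do rewrite sumrB.
  rewrite sumrB; congr (_ - _).
  rewrite [RHS](bigD1 s)//= [X in _ = _ + X]big1 ?addr0; last first.
    by move=> s' /negbTE s's; rewrite big1// => a _; rewrite s's mul0r.
  by apply: eq_bigr => a _; rewrite eqxx mul1r.
- rewrite -l_sum (sum_stage_avail (fun _ _ => 1) l_out).
  by apply: eq_bigr => s _; apply: eq_bigr => a _; rewrite mul1r.
- rewrite -l_sum (sum_stage_power l (fun _ _ => 1)).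
  by apply: eq_bigr => s _; apply: eq_bigr => p _; rewrite mul1r.
- by rewrite /drop_rate; under eq_bigr do under eq_bigr do rewrite /Y2 l_power.
Unshelve. all: by end_near. Qed.

(** * The stationary policy read off a feasible solution *)

Variables (X1 : 'I_N -> A -> R) (X2 : 'I_N -> 'I_M -> R).
Hypotheses (X_same : same_states D X1 X2) (X_lp : lp_constraints D W bound X1 X2).
Variables (d1 : 'I_N -> A -> R) (d2 : 'I_N -> 'I_M -> R).
Hypotheses (d1P : control_rule D d1) (d2P : power_rule d2).

Local Notation num := (lp_control D X1 d1).
Local Notation nup := (lp_power X2 d2).
Local Notation pi := (state_marginal1 D X1).

Lemma state_marginal1_ge0 s : 0 <= pi s.
Proof. by apply: sumr_ge0 => a aD; apply: (lp_ge0_1 X_lp). Qed.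

Lemma lp_control_rule : control_rule D num.
Proof.
move=> s; have [d1_ge0 d1_out d1_sum] := d1P s; rewrite /lp_control.
case: eqP => [//|/eqP pi0]; split.
- move=> a; case: ifP => // aD.
  by rewrite divr_ge0 ?state_marginal1_ge0// (lp_ge0_1 X_lp).
- by move=> a /negbTE ->.
- by rewrite -big_mkcond -mulr_suml divff.
Qed.

Lemma lp_power_rule : power_rule nup.
Proof.
move=> s; have [d2_ge0 d2_sum] := d2P s; rewrite /lp_power.
case: eqP => [//|/eqP pi0]; split; last by rewrite -mulr_suml divff.
by move=> p; rewrite -X_same divr_ge0 ?state_marginal1_ge0// (lp_ge0_2 X_lp).
Qed.

(** This survives a zero marginal, whatever [d1] is: nonnegative terms of sum 0 all vanish. *)
Lemma lp_control_marginal s a : a \in avail D s -> pi s * num s a = X1 s a.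
Proof.
move=> aD; rewrite /lp_control aD; case: (eqVneq (pi s) 0) => pi0.
  rewrite pi0 mul0r; apply/esym/(psumr_eq0P _ pi0) => // b; exact: (lp_ge0_1 X_lp).
by rewrite mulrC divfK.
Qed.

Lemma lp_power_marginal s p : nup s p * pi s = X2 s p.
Proof.
rewrite X_same /lp_power; case: (eqVneq (state_marginal2 X2 s) 0) => pi0;
  last by rewrite divfK.
rewrite pi0 mulr0; apply/esym/(psumr_eq0P _ pi0) => // q _; exact: (lp_ge0_2 X_lp).
Qed.

(** Once [X1] is factored as [pi] times [num], the balance constraints are the invariance of
    [pi]. *)
Lemma lp_stationary_dist : stationary_dist (rule_matrix D num) pi.
Proof.
split; [exact: state_marginal1_ge0 | exact: (lp_sum1_1 X_lp) | move=> s].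
have /eqP := lp_balance X_lp s; rewrite subr_eq0 -/(pi s) => /eqP ->.
apply: eq_bigr => s' _; rewrite mxE mulr_sumr; apply: eq_bigr => a aD.
by rewrite mulrA lp_control_marginal// mulrC.
Qed.

Hypothesis uni : unichain D.
Variable s0 : 'I_N.

Local Notation mum := (stationary_control num : control_policy R N M A).
Local Notation mup := (stationary_power nup : power_policy R N M A).

Let numP : is_control_policy D mum.
Proof. by move=> h; apply: lp_control_rule. Qed.

Let nupP : is_power_policy mup.
Proof. by move=> h; apply: lp_power_rule. Qed.

(** The limit of the occupation measures under the stationary policy. Its marginals are [X1], on
    available actions, and [X2], which gives the policy the cost and the drop rate of the
    solution. *)
Let joint (x : stage N M A) : R := pi x.1.1 * num x.1.1 x.1.2 * nup x.1.1 x.2.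

Let joint_cvg (g : stage N M A -> R) :
  \sum_x g x * occupation D s0 mum mup T x @[T --> \oo] --> \sum_x g x * joint x.
Proof.
apply: cvg_linear => x.
exact: (stationary_occupation_cvg s0 lp_control_rule lp_power_rule uni
  lp_stationary_dist).
Qed.

Let joint_out s a p : a \notin avail D s -> joint (s, a, p) = 0.
Proof.
move=> aD; have [_ num_out _] := lp_control_rule s.
by rewrite /joint /= num_out// mulr0 mul0r.
Qed.

Let joint_power s p : \sum_a joint (s, a, p) = X2 s p.
Proof.
have [_ _ num_sum] := lp_control_rule s.
rewrite -lp_power_marginal /joint /= -mulr_suml -mulr_sumr num_sum mulr1.
exact: mulrC.
Qed.

Lemma lp_joint_stationary : joint_stationary D s0 mum mup (fun s p => nup s p * pi s).
Proof.
apply/occupation_power => s p.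
rewrite lp_power_marginal -joint_power.
rewrite (_ : \sum_a _ = \sum_x ((x.1.1 == s) && (x.2 == p))%:R * joint x).
  exact: joint_cvg.
rewrite (sum_stage_power joint (fun s' p' => ((s' == s) && (p' == p))%:R)).
rewrite (bigD1 s)//= [X in _ = _ + X]big1 ?addr0; last first.
  by move=> s' /negbTE s's; rewrite big1// => p' _; rewrite s's mul0r.
rewrite (bigD1 p)//= !eqxx mul1r [X in _ = _ + X]big1 ?addr0//.
by move=> p' /negbTE ->; rewrite andbF mul0r.
Qed.

Lemma lp_average_cost :
  average_cost D W s0 mum mup lambda (lp_cost D W lambda X1 X2).
Proof.
apply/(occupation_cost s0 numP nupP).
rewrite (_ : lp_cost _ _ _ _ _ =
  \sum_x (cost D x.1.1 x.1.2 + lambda * power_cost W x.2) * joint x).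
  exact: joint_cvg.
rewrite (lp_cost_joint W lambda joint_out); congr (_ + _ * _).
  apply: eq_bigr => s _; apply: eq_bigr => a aD; congr (_ * _).
  have [_ nup_sum] := lp_power_rule s.
  by rewrite /joint /= -mulr_sumr nup_sum mulr1 lp_control_marginal.
by apply: eq_bigr => s _; apply: eq_bigr => p _; rewrite joint_power.
Qed.

Lemma lp_admissible : admissible D W lambda bound s0 mum mup (lp_cost D W lambda X1 X2).
Proof.
split; [exact: numP | exact: nupP | | exact: lp_average_cost].
exists (fun s p => nup s p * pi s); first exact: lp_joint_stationary.
rewrite /drop_rate; under eq_bigr do under eq_bigr do rewrite lp_power_marginal.
exact: (lp_safety X_lp).
Qed.

End Optimality.

Theorem mainTheorem4 (R : realType) (N M : nat) (A : finType)
    (D : mdp R N A) (W : channel R N M)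
    (lambda rho lambda0 lambda1 : R)
    (lambda_gt0 : 0 < lambda) (rho_gt0 : 0 < rho)
    (lambda0_gt0 : 0 < lambda0) (lambda1_gt0 : 0 < lambda1)
    (lambda10 : lambda1 < lambda0) (rho_lambda1 : rho * lambda1 < 1)
    (uni : unichain D)
    (X1 : 'I_N -> A -> R) (X2 : 'I_N -> 'I_M -> R)
    (X_opt : lp_optimal D W lambda (safety_bound rho lambda0 lambda1) X1 X2)
    (d1 : 'I_N -> A -> R) (d2 : 'I_N -> 'I_M -> R)
    (d1_rule : control_rule D d1) (d2_rule : power_rule d2)
    (s0 : 'I_N) :
  let num := lp_control D X1 d1 in
  let nup := lp_power X2 d2 in
  let mum : control_policy R N M A := stationary_control num in
  let mup : power_policy R N M A := stationary_power nup in
  optimal_policy D W lambda (safety_bound rho lambda0 lambda1) s0 mum mup /\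
  exists2 pi : 'I_N -> R, stationary_dist (rule_matrix D num) pi &
    joint_stationary D s0 mum mup (fun s p => nup s p * pi s).
Proof.
move=> num nup mum mup; have [X_same X_lp X_min] := X_opt; split.
  exists (lp_cost D W lambda X1 X2); first exact: lp_admissible.
  (* The cost of any competitor is the objective value of a feasible pair. *)
  move=> mm mp J /admissible_lp_feasible[Y1 [Y2 [Y_same Y_lp <-]]].
  exact: X_min.
exists (state_marginal1 D X1); first exact: (lp_stationary_dist X_lp).
exact: (lp_joint_stationary X_same X_lp).
Qed.
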